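(* Let $K$ be an algebraically closed field and let $\mathcal{M}=(\mathcal{M},[0],\ast)$ be the associative monoid of isomorphism classes of objects of $\mathcal{S}_1$ with $[X]\ast[Y]=[X\ast Y]$ (generic extension) and unit the class $[0]$ of the zero object. The monoid $\mathcal{M}$ is generated by the set $$\{[P_1^1]\}\cup\{[(P_0^1)^{\oplus n}] : n\ge1\}.$$
   Context: For a partition $\lambda=(\lambda_1\ge\lambda_2\ge\dots)$ put $N_\lambda=\bigoplus_iK[T]/(T^{\lambda_i})$. $\mathcal{S}$ is the category of triples $(N_\alpha,N_\beta,f)$ with $f:N_\alpha\to N_\beta$ an injective $K[T]$-homomorphism; morphisms $(N_\alpha,N_\beta,f)\to(N_{\alpha'},N_{\beta'},f')$ are pairs $(\psi_1,\psi_2)$ of $K[T]$-homomorphisms with $f'\psi_1=\psi_2f$. $\mathcal{S}_1$ is the full subcategory of objects with $\alpha_1\le1$ (semisimple invariant subspaces). $P_0^1=(0,K[T]/(T),0)$ and $P_1^1=(K[T]/(T),K[T]/(T),\mathrm{id})$. An object $Z\in\mathcal{S}_1$ is an extension of $Y\in\mathcal{S}_1$ by $X\in\mathcal{S}_1$ if there is a short exact sequence $0\to X\to Z\to Y\to0$ (exact in both components). The generic extension $Y\ast X$ of $Y$ by $X$ is the unique (up to isomorphism) extension $Z\in\mathcal{S}_1$ of $Y$ by $X$ with minimal $K$-dimension of $\operatorname{End}_{\mathcal{S}}(Z)$; over an algebraically closed field it always exists in $\mathcal{S}_1$, and the operation $\ast$ is associative. *)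

(* Defs.v *)
From HB Require Import structures.
From mathcomp Require Import all_boot all_order all_algebra.
From mathcomp Require Import generic_quotient boolp classical_sets.

Set Implicit Arguments.
Unset Strict Implicit.
Unset Printing Implicit Defensive.

Import GRing.Theory.
Local Open Scope quotient_scope.
Local Open Scope classical_set_scope.
Local Open Scope ring_scope.

Definition is_partition (s : seq nat) : bool := sorted geq s && (0%N \notin s).

Record partition := Partition {
  parts :> seq nat;
  partsP : is_partition parts
}.

Lemma is_partition_nseq1 n : is_partition (nseq n 1%N).
Proof.
rewrite /is_partition mem_nseq andbF andbT.
by case: n => //= n; elim: n => //= n ->; rewrite andbT.
Qed.

(* The partition (1, ..., 1) with n parts. *)
Definition part1 (n : nat) : partition := Partition (is_partition_nseq1 n).

Section Modules.
Variable K : fieldType.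

(* K[T]/(T^l1) * (K[T]/(T^l2) * (... * 0)), as a K-vector space.  Only used
   for sequences without zeros: the library reads {poly %/ 'X^0} as
   {poly %/ 'X}. *)
Fixpoint N (l : seq nat) : vectType K :=
  if l is n :: l' then ({poly %/ ('X^n : {poly K})} * N l')%type : vectType K
  else 'rV[K]_0.

(* The action of K[T] on N l. *)
Fixpoint act (l : seq nat) (p : {poly K}) : N l -> N l :=
  match l return N l -> N l with
  | [::] => fun x => x
  | n :: l' => fun x => (in_qpoly 'X^n p * x.1, @act l' p x.2)
  end.

Lemma act_is_linear l p : linear (@act l p).
Proof.
elim: l => [|n l IHl] //= a [x1 x2] [y1 y2].
by apply/pair_equal_spec; split=> /=; rewrite ?IHl // mulrDr scalerAr.
Qed.

HB.instance Definition _ l p :=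
  GRing.isLinear.Build K (N l) (N l) _ (@act l p) (@act_is_linear l p).

Lemma actC l (c : K) x : @act l c%:P x = c *: x.
Proof.
elim: l x => [|n l IHl] x /=; first by rewrite thinmx0 [RHS]thinmx0.
rewrite {}IHl; case: x => x1 x2; apply/pair_equal_spec; split=> //=.
by rewrite -[c%:P]mulr1 mul_polyC in_qpolyZ in_qpoly1 -scalerAl mul1r.
Qed.

Lemma actD l p q x : @act l (p + q) x = act p x + act q x.
Proof.
elim: l x => [|n l IHl] x /=; first by rewrite thinmx0 [RHS]thinmx0.
by rewrite IHl in_qpolyD mulrDl.
Qed.

Lemma actM l p q x : @act l (p * q) x = act p (act q x).
Proof. by elim: l x => [|n l IHl] //= x; rewrite IHl rmorphM mulrA. Qed.

Lemma dim_N l : 0%N \notin l -> \dim {:N l} = sumn l.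
Proof.
rewrite dimvf; elim: l => [|n l IHl] /=; first by rewrite /dim /= muln0.
rewrite inE eq_sym negb_or => /andP[n0 /IHl {}IHl].
rewrite -IHl; congr addn.
by rewrite [LHS]/dim /= mk_monic_Xn size_polyXn /= prednK // lt0n.
Qed.

Definition Thom (l m : seq nat) (f : 'Hom(N l, N m)) : Prop :=
  forall p x, f (act p x) = act p (f x).

Definition Tend (l : seq nat) : 'End(N l) := linfun (@act l 'X).

Lemma ThomE l m (f : 'Hom(N l, N m)) :
  Thom f <-> (f \o Tend l = Tend m \o f)%VF.
Proof.
split=> [fT|/lfunP fT].
  by apply/lfunP => x; rewrite !comp_lfunE !lfunE /=; exact: fT.
have fX x : f (act 'X x) = act 'X (f x).
  by have := fT x; rewrite !comp_lfunE !lfunE.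
elim/poly_ind => [|p c IHp] x; first by rewrite -polyC0 !actC !scale0r linear0.
by rewrite !actD linearD !actC linearZ /= !actM IHp fX.
Qed.

Record obj := Obj {
  sub : partition;
  amb : partition;
  emb : 'Hom(N sub, N amb);
  emb_Thom : Thom emb;
  emb_inj : lker emb == 0%VS
}.

Record mor (X Y : obj) := Mor {
  mor1 : 'Hom(N (sub X), N (sub Y));
  mor2 : 'Hom(N (amb X), N (amb Y));
  mor1_Thom : Thom mor1;
  mor2_Thom : Thom mor2;
  mor_comm : (emb Y \o mor1 = mor2 \o emb X)%VF
}.

Definition iso (X Y : obj) : Prop := exists (f : mor X Y) (g : mor Y X),
  [/\ (mor1 g \o mor1 f = \1)%VF, (mor2 g \o mor2 f = \1)%VF,
      (mor1 f \o mor1 g = \1)%VF & (mor2 f \o mor2 g = \1)%VF].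

Definition short_exact (U V W : vectType K) (f : 'Hom(U, V)) (g : 'Hom(V, W)) :
    Prop :=
  [/\ lker f = 0%VS, limg f = lker g & limg g = fullv].

(* Z is an extension of Y by X. *)
Definition extension (Y X Z : obj) : Prop :=
  exists (f : mor X Z) (g : mor Z Y),
    short_exact (mor1 f) (mor1 g) /\ short_exact (mor2 f) (mor2 g).

Definition End_defect (Z : obj)
    (u : 'End(N (sub Z)) * 'End(N (amb Z))) :
    'End(N (sub Z)) * 'End(N (amb Z)) * 'Hom(N (sub Z), N (amb Z)) :=
  (((u.1 \o Tend _)%VF - (Tend _ \o u.1)%VF,
    (u.2 \o Tend _)%VF - (Tend _ \o u.2)%VF),
   (emb Z \o u.1)%VF - (u.2 \o emb Z)%VF).

Lemma End_defect_is_linear Z : linear (@End_defect Z).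
Proof.
move=> a u v; rewrite /End_defect /=.
rewrite !(comp_lfunDl, comp_lfunDr) -!(comp_lfunZl, comp_lfunZr).
by do 2?[apply/pair_equal_spec; split] => /=;
  rewrite opprD addrACA scalerBr.
Qed.

HB.instance Definition _ Z :=
  GRing.isLinear.Build K _ _ _ (@End_defect Z) (@End_defect_is_linear Z).

(* The K-vector space of endomorphisms of Z, as a space of pairs of
   K-linear maps; see mem_EndS. *)
Definition EndS (Z : obj) : {vspace 'End(N (sub Z)) * 'End(N (amb Z))} :=
  lker (linfun (@End_defect Z)).

Lemma mem_EndS Z u :
  u \in EndS Z <-> exists h : mor Z Z, u = (mor1 h, mor2 h).
Proof.
rewrite memv_ker lfunE /=; split.
  case: u => u1 u2 /eqP[] /= /subr0_eq h1 /subr0_eq h2 /subr0_eq h3.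
  by exists (Mor ((ThomE _).2 h1) ((ThomE _).2 h2) h3).
case=> h ->; rewrite /End_defect /= (mor_comm h).
by rewrite ((ThomE _).1 (mor1_Thom h)) ((ThomE _).1 (mor2_Thom h)) !subrr.
Qed.

Record obj1 := Obj1 {
  obj1_val :> obj;
  obj1P : (head 0 (sub obj1_val) <= 1)%N
}.

HB.instance Definition _ := gen_eqMixin obj1.
HB.instance Definition _ := gen_choiceMixin obj1.

Definition is_generic_extension (Y X Z : obj1) : Prop :=
  extension Y X Z /\
  forall Z' : obj1, extension Y X Z' -> (\dim (EndS Z) <= \dim (EndS Z'))%N.

Lemma P0_Thom n : Thom (0 : 'Hom(N (part1 0), N (part1 n))).
Proof. by move=> p x; rewrite !lfunE /= linear0. Qed.

Lemma P0_inj n : lker (0 : 'Hom(N (part1 0), N (part1 n))) == 0%VS.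
Proof. by apply/lker0P => x y _; rewrite (thinmx0 x) (thinmx0 y). Qed.

(* The n-fold direct sum of (0, K[T]/(T), 0), that is (0, (K[T]/(T))^n, 0);
   see P01_sumS. *)
Definition P01_sum (n : nat) : obj1 :=
  @Obj1 (Obj (@P0_Thom n) (P0_inj n)) isT.

Definition P01 : obj1 := P01_sum 1.

Definition zero_obj : obj1 := P01_sum 0.

Lemma P11_Thom : Thom (\1%VF : 'End(N (part1 1))).
Proof. by move=> p x; rewrite !id_lfunE. Qed.

Lemma P11_inj : lker (\1%VF : 'End(N (part1 1))) == 0%VS.
Proof. by apply/lker0P => x y; rewrite !id_lfunE. Qed.

Definition P11 : obj1 := @Obj1 (Obj P11_Thom P11_inj) isT.

Definition biproduct (U V W : vectType K)
    (i : 'Hom(U, W)) (j : 'Hom(V, W)) (p : 'Hom(W, U)) (q : 'Hom(W, V)) :=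
  [/\ (p \o i = \1)%VF, (q \o j = \1)%VF, (p \o j = 0)%VF, (q \o i = 0)%VF
    & (i \o p)%VF + (j \o q)%VF = \1%VF].

Definition direct_sum (X Y Z : obj) : Prop :=
  exists (i : mor X Z) (j : mor Y Z) (p : mor Z X) (q : mor Z Y),
    biproduct (mor1 i) (mor1 j) (mor1 p) (mor1 q) /\
    biproduct (mor2 i) (mor2 j) (mor2 p) (mor2 q).

Lemma P01_sumS n : direct_sum P01 (P01_sum n) (P01_sum n.+1).
Proof.
pose A : vectType K := N (part1 1); pose B : vectType K := N (part1 n).
pose C : vectType K := N (part1 n.+1).
pose i (x : A) : C := (x.1, 0); pose j (y : B) : C := (0, y).
pose p (z : C) : A := (z.1, 0); pose q (z : C) : B := z.2.
have iL : linear i.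
  by move=> a x y; apply/pair_equal_spec; split=> //=; rewrite scaler0 addr0.
have jL : linear j.
  by move=> a x y; apply/pair_equal_spec; split=> //=; rewrite scaler0 addr0.
have pL : linear p.
  by move=> a x y; apply/pair_equal_spec; split=> //=; rewrite scaler0 addr0.
have qL : linear q by [].
pose fi := linfun (HB.pack_for {linear A -> C} i (GRing.isLinear.Build _ _ _ _ i iL)).
pose fj := linfun (HB.pack_for {linear B -> C} j (GRing.isLinear.Build _ _ _ _ j jL)).
pose fp := linfun (HB.pack_for {linear C -> A} p (GRing.isLinear.Build _ _ _ _ p pL)).
pose fq := linfun (HB.pack_for {linear C -> B} q (GRing.isLinear.Build _ _ _ _ q qL)).
have fiT : Thom fi.
  move=> r x; rewrite !lfunE; apply/pair_equal_spec; split=> //=.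
  by symmetry; exact: (linear0 (@act (nseq n 1%N) r)).
have fjT : Thom fj.
  move=> r x; rewrite !lfunE; apply/pair_equal_spec; split=> //=.
  by rewrite mulr0.
have fpT : Thom fp by move=> r x; rewrite !lfunE; apply/pair_equal_spec.
have fqT : Thom fq by move=> r x; rewrite !lfunE.
have T0 : Thom (0 : 'Hom(N (part1 0), N (part1 0))) by exact: P0_Thom.
have c0 m1 m2 (h : 'Hom(N (part1 m1), N (part1 m2))) :
    ((0 : 'Hom(N (part1 0), N (part1 m2))) \o 0
     = h \o (0 : 'Hom(N (part1 0), N (part1 m1))))%VF.
  by rewrite comp_lfun0l comp_lfun0r.
exists (@Mor P01 (P01_sum n.+1) 0 fi T0 fiT (c0 _ _ _)).
exists (@Mor (P01_sum n) (P01_sum n.+1) 0 fj T0 fjT (c0 _ _ _)).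
exists (@Mor (P01_sum n.+1) P01 0 fp T0 fpT (c0 _ _ _)).
exists (@Mor (P01_sum n.+1) (P01_sum n) 0 fq T0 fqT (c0 _ _ _)).
split.
  by split; apply/lfunP => x; rewrite [LHS]thinmx0 [RHS]thinmx0.
split; apply/lfunP => x; rewrite ?(add_lfunE, comp_lfunE, id_lfunE, zero_lfunE).
- rewrite !lfunE; case: x => x1 x2; apply/pair_equal_spec; split=> //=.
  by rewrite [RHS]thinmx0.
- by rewrite !lfunE.
- by rewrite !lfunE.
- by rewrite !lfunE.
- rewrite !lfunE; case: x => x1 x2; apply/pair_equal_spec.
  by split=> /=; rewrite ?addr0 ?add0r.
Qed.

Lemma iso_refl X : iso X X.
Proof.
have T l : Thom (\1%VF : 'End(N l)) by move=> p x; rewrite !id_lfunE.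
have c : (emb X \o \1 = \1 \o emb X)%VF by rewrite comp_lfun1l comp_lfun1r.
exists (Mor (T _) (T _) c), (Mor (T _) (T _) c).
by split; exact: comp_lfun1l.
Qed.

Lemma iso_sym X Y : iso X Y -> iso Y X.
Proof. by case=> f [g [? ? ? ?]]; exists g, f. Qed.

Lemma comp_Thom l m n (f : 'Hom(N l, N m)) (g : 'Hom(N m, N n)) :
  Thom f -> Thom g -> Thom (g \o f)%VF.
Proof. by move=> fT gT p x; rewrite !comp_lfunE fT gT. Qed.

Definition comp_mor X Y Z (g : mor Y Z) (f : mor X Y) : mor X Z.
Proof.
refine (Mor (comp_Thom (mor1_Thom f) (mor1_Thom g))
            (comp_Thom (mor2_Thom f) (mor2_Thom g)) _).
by rewrite comp_lfunA mor_comm -comp_lfunA mor_comm comp_lfunA.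
Defined.

Lemma iso_trans X Y Z : iso X Y -> iso Y Z -> iso X Z.
Proof.
case=> f [f' [a1 a2 a3 a4]] [g [g' [b1 b2 b3 b4]]].
exists (comp_mor g f), (comp_mor f' g').
have E (U V W : vectType K) (u : 'Hom(U, V)) (u' : 'Hom(V, U))
    (v : 'Hom(V, W)) (v' : 'Hom(W, V)) :
    (u' \o u = \1 -> v' \o v = \1 -> (u' \o v') \o (v \o u) = \1)%VF.
  by move=> hu hv; rewrite -comp_lfunA (comp_lfunA v') hv comp_lfun1l.
by split; exact: E.
Qed.

Definition isob (X Y : obj1) : bool := `[< iso X Y >].

Lemma isob_refl : reflexive isob.
Proof. by move=> X; apply/asboolP; exact: iso_refl. Qed.

Lemma isob_sym : symmetric isob.
Proof. by move=> X Y; apply/asboolP/asboolP; exact: iso_sym. Qed.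

Lemma isob_trans : transitive isob.
Proof.
by move=> Y X Z /asboolP XY /asboolP YZ; apply/asboolP; exact: iso_trans YZ.
Qed.

Canonical isob_equiv := EquivRel isob isob_refl isob_sym isob_trans.

Definition M := {eq_quot isob}.

Definition cls (X : obj1) : M := \pi X.

Lemma clsP X Y : cls X = cls Y <-> iso X Y.
Proof. by split=> [/eqmodP/asboolP|XY]; last exact/eqmodP/asboolP. Qed.

(* Y * X.  The set of minimal extensions is an isomorphism class when K is
   algebraically closed, so the choice made here does not affect the class. *)
Definition generic_extension (Y X : obj1) : obj1 :=
  xget zero_obj [set Z | is_generic_extension Y X Z].

Definition mulM (a b : M) : M := cls (generic_extension (repr a) (repr b)).

Lemma extension_iso (X X' Y Y' Z : obj) :
  iso X X' -> iso Y Y' -> extension Y X Z -> extension Y' X' Z.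
Proof.
case=> u [u' [u1 u2 u3 u4]] [v [v' [v1 v2 v3 v4]]] [f [g [fg1 fg2]]].
exists (comp_mor f u'), (comp_mor v g).
have E (U U' V W W' : vectType K) (r : 'Hom(U, U')) (r' : 'Hom(U', U))
    (s : 'Hom(W, W')) (s' : 'Hom(W', W)) (h : 'Hom(U, V)) (k : 'Hom(V, W)) :
    (r' \o r = \1 -> r \o r' = \1 -> s' \o s = \1 -> s \o s' = \1 ->
    short_exact h k -> short_exact (h \o r') (s \o k))%VF.
  move=> r1 r2 s1 s2 [kerh imh imk].
  have inj (A B : vectType K) (a : 'Hom(A, B)) (b : 'Hom(B, A)) :
      (b \o a = \1 -> lker a = 0%VS)%VF.
    move=> e; apply/eqP/lker0P => x y exy.
    by rewrite -[x]id_lfunE -[y]id_lfunE -e !comp_lfunE exy.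
  have surj (A B : vectType K) (a : 'Hom(A, B)) (b : 'Hom(B, A)) :
      (a \o b = \1 -> limg a = fullv)%VF.
    move=> e; apply/eqP; rewrite eqEsubv subvf /=; apply/subvP => x _.
    by rewrite -[x]id_lfunE -e comp_lfunE memv_img // memvf.
  split.
  - apply/eqP/lker0P => x y; rewrite !comp_lfunE.
    by move=> /(lker0P (introT eqP kerh)) /(lker0P (introT eqP (inj _ _ _ _ r2))).
  - rewrite limg_comp (surj _ _ _ _ r1) imh; apply/vspaceP => x.
    by rewrite !memv_ker comp_lfunE -[RHS](memv_ker s) (inj _ _ _ _ s1) memv0.
  - by rewrite limg_comp imk (surj _ _ _ _ s2).
by split; [exact: (E _ _ _ _ _ _ _ _ _ _ _ u1 u3 v1 v3)
         |exact: (E _ _ _ _ _ _ _ _ _ _ _ u2 u4 v2 v4)].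
Qed.

Lemma generic_extension_iso (X X' Y Y' : obj1) :
  iso X X' -> iso Y Y' -> generic_extension Y X = generic_extension Y' X'.
Proof.
move=> XX' YY'; congr (xget _ _); apply/seteqP; split=> Z [eZ minZ]; split.
- exact: extension_iso eZ.
- move=> Z' eZ'; apply: minZ.
  by apply: extension_iso eZ'; exact: iso_sym.
- by apply: extension_iso eZ; exact: iso_sym.
- by move=> Z' eZ'; apply: minZ; exact: extension_iso eZ'.
Qed.

Lemma mulM_cls (Y X : obj1) : mulM (cls Y) (cls X) = cls (generic_extension Y X).
Proof. by congr cls; apply: generic_extension_iso; apply/clsP; exact: reprK. Qed.

Definition submonoid (A : set M) : Prop :=
  A (cls zero_obj) /\ forall a b, A a -> A b -> A (mulM a b).

End Modules.

(* Main.v *)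
Require Import Defs.
From HB Require Import structures.
From mathcomp Require Import all_boot all_algebra.
From mathcomp Require Import boolp classical_sets.

(** An object [Z] is a nilpotent operator [T] on a space [V] together with a
    subspace [U] of [ker T]; every nonzero [Z] is a generic extension of a
    generator by an object of smaller dimension, in one of two ways.

    If [U] is not contained in [T V], a vector of [U] outside [T V] spans a
    direct summand isomorphic to [P_1^1] (lemma [peel_P11]).  Every extension of
    [P_1^1] by an object [X] splits, so all of them are isomorphic
    ([extension_P11_unique]), and [Z] is the generic one.

    If [U] is contained in [T V] and [n := dim V / T V], put
    [X := (U <= T V)]; then [Z] is an extension of [(P_0^1)^n] by [X]
    ([peel_P0]).  Any extension [Z' = (U' <= V')] of [(P_0^1)^n] by [X] satisfies
    [dim End(Z') >= dim End(X) + n^2], with equality only if [T V'] is the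
    image of [X] ([dim_End_extension_ge]), whereas [Z] attains this bound
    ([dim_End_extension_le]).  So a minimal [Z'] has [T V'] isomorphic to [T V]
    compatibly with the subspaces, and this isomorphism extends to one between
    [V'] and [V] ([extend_over_radical]).

    To view the pairs [(U <= T V)] and [(U :&: H <= H)] as objects, one needs
    the structure theorem for nilpotent operators ([Jordan_form]).  It follows by
    induction from the same extension lemma, since the dimension of [V] and the
    isomorphism type of [T V] determine that of [V]. *)

Set Implicit Arguments.
Unset Strict Implicit.
Unset Printing Implicit Defensive.

Import GRing.Theory.
Local Open Scope ring_scope.
Local Open Scope classical_set_scope.

(** * Extending and gluing linear maps *)

Section LinearAlgebra.
Variable K : fieldType.
Implicit Types A B C V : vectType K.

Lemma glue_lfun A B (P Q : {vspace A}) (f1 f2 : 'Hom(A, B)) :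
  {in (P :&: Q)%VS, f1 =1 f2} ->
  exists f : 'Hom(A, B), {in P, f =1 f1} /\ {in Q, f =1 f2}.
Proof.
move=> f12; exists ((f1 \o addv_pi1 P Q)%VF + (f2 \o addv_pi2 P Q)%VF).
have pi12 x : x \in (P + Q)%VS -> addv_pi1 P Q x = x - addv_pi2 P Q x.
  by move=> /addv_pi1_pi2 {2}<-; rewrite addrK.
split=> x xPQ; rewrite add_lfunE !comp_lfunE.
  have pQ := memv_pi2 P Q x; have xS : x \in (P + Q)%VS.
    by rewrite -[x]addr0 memv_add ?mem0v.
  have pP : addv_pi2 P Q x \in P.
    rewrite -[addv_pi2 P Q x](subKr x) -pi12 // rpredB //.
    exact: memv_pi1.
  by rewrite -f12 ?memv_cap ?pP // pi12 // linearB subrK.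
have xS : x \in (P + Q)%VS by rewrite -[x]add0r memv_add ?mem0v.
by rewrite pi12 // addv_pi2_id // subrr linear0 add0r.
Qed.

Lemma ex_lfun_img A B (P : {vspace A}) (Q : {vspace B}) :
  \dim P = \dim Q -> exists f : 'Hom(A, B), (f @: P)%VS = Q.
Proof.
move=> dPQ; have [f fP] := linear_of_free (vbasis P) (vbasis Q).
exists (linfun f).
rewrite -(span_basis (vbasisP P)) -(span_basis (vbasisP Q)) limg_span.
rewrite -[in RHS]fP ?(basis_free (vbasisP _)) ?size_tuple //.
by congr span; apply: eq_map => x; rewrite lfunE.
Qed.

Lemma extend_lfun_img A B (I P : {vspace A}) (Q : {vspace B})
    (f : 'Hom(A, B)) :
  (I <= P)%VS -> (f @: I <= Q)%VS -> (I :&: lker f)%VS = 0%VS ->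
  \dim P = \dim Q ->
  exists g : 'Hom(A, B), {in I, g =1 f} /\ (g @: P)%VS = Q.
Proof.
move=> IP fIQ kerI dPQ.
have [h hP] : exists h : 'Hom(A, B), (h @: (P :\: I))%VS = (Q :\: f @: I)%VS.
  apply: ex_lfun_img; apply/eqP; rewrite -(eqn_add2l (\dim I)) -{1}(capv_idPr IP).
  by rewrite dimv_cap_compl dPQ -(dimv_cap_compl Q (f @: I)%VS) (capv_idPr fIQ)
             limg_dim_eq.
have [g [gI gP]] : exists g : 'Hom(A, B),
    {in I, g =1 f} /\ {in (P :\: I)%VS, g =1 h}.
  apply: glue_lfun => x; rewrite capvC capv_diff memv0 => /eqP ->.
  by rewrite !linear0.
exists g; split=> //.
rewrite -{1}(addv_idPl IP) -addv_diff limgD (eq_in_limg gI) (eq_in_limg gP) hP.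
by rewrite addv_diff (addv_idPl fIQ).
Qed.

Lemma dim_limg_inj A B (f : 'Hom(A, B)) (P : {vspace A}) :
  lker f = 0%VS -> \dim (f @: P) = \dim P.
Proof. by move=> kf; rewrite limg_dim_eq // kf capv0. Qed.

(** The key extension result.  Here [A] plays the part of [t' B] and of [t H] at
    once; the map [f \o j^-1] between these two images extends to an
    isomorphism [B -> H] of modules.  A linear map [g] extending it commutes
    with the nilpotent operators exactly when [t g = S], with
    [S := f j^-1 t'].  This leaves [g] free up to [ker t], and that freedom
    suffices for injectivity: a vector killed by [g] lies in [ker t'], so it is
    enough to choose [g] injective on [ker t'].  Since [ker t'] and
    [H :&: ker t] have the same dimension, such a choice [k] exists that agrees
    with [f j^-1] on the intersection of [ker t'] with [limg j]. *)
Lemma extend_over_radical A B V (s : 'End(A)) (t' : 'End(B)) (t : 'End(V))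
    (H : {vspace V}) (j : 'Hom(A, B)) (f : 'Hom(A, V)) :
  lker j = 0%VS -> (limg j = limg t')%VS -> (t' \o j = j \o s)%VF ->
  lker f = 0%VS -> (limg f = t @: H)%VS -> (t \o f = f \o s)%VF ->
  (t @: H <= H)%VS -> \dim {:B} = \dim H ->
  exists g : 'Hom(B, V),
    [/\ lker g = 0%VS, limg g = H, (t \o g = g \o t')%VF & (g \o j = f)%VF].
Proof.
move=> kj ij tj kf if_ tf tH dBH.
have jK : cancel j j^-1%VF by apply: lker0_lfunK; rewrite kj.
have tjE x : t' (j x) = j (s x) by rewrite -comp_lfunE tj comp_lfunE.
have tfE x : t (f x) = f (s x) by rewrite -comp_lfunE tf comp_lfunE.
pose q := (f \o j^-1)%VF; have qE x : q (j x) = f x by rewrite comp_lfunE jK.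
pose S := (q \o t')%VF.
have jt' x : exists a, t' x = j a.
  have : t' x \in limg j by rewrite ij memv_img ?memvf.
  by case/memv_imgP=> a _ ->; exists a.
have SE x : S x = 0 -> t' x = 0.
  rewrite /S comp_lfunE; case: (jt' x) => a ->; rewrite qE => /eqP.
  by rewrite -memv_ker kf memv0 => /eqP ->; rewrite linear0.
have StH x : S x \in (t @: H)%VS.
  rewrite /S comp_lfunE; case: (jt' x) => a ->.
  by rewrite qE -if_ memv_img ?memvf.
have dA : \dim (limg t') = \dim (t @: H)%VS.
  by rewrite -ij -if_ !dim_limg_inj.
pose I := (lker t' :&: limg j)%VS.
have [k [kI kP]] : exists k : 'Hom(B, V),
    {in I, k =1 q} /\ (k @: lker t')%VS = (H :&: lker t)%VS.
  apply: extend_lfun_img.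
  - exact: capvSl.
  - apply/subvP => _ /memv_imgP[x /memv_capP[xk /memv_imgP[a _ xa]] ->].
    rewrite xa qE memv_cap memv_ker tfE; apply/andP; split.
      by apply: (subvP tH); rewrite -if_ memv_img ?memvf.
    by move: xk; rewrite memv_ker xa tjE -qE => /eqP ->; rewrite linear0.
  - apply/eqP; rewrite -subv0; apply/subvP => x.
    case/memv_capP=> /memv_capP[_ /memv_imgP[a _ ->]].
    by rewrite memv_ker qE -memv_ker kf !memv0 => /eqP ->; rewrite linear0.
  - apply/eqP; rewrite -(eqn_add2r (\dim (t @: H)%VS)) limg_ker_dim.
    by rewrite -dA -dBH -(limg_ker_dim t' fullv) capvC capvf.
have [g1 [g1j g1k]] : exists g : 'Hom(B, V),
    {in limg j, g =1 q} /\ {in lker t', g =1 k}.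
  by apply: glue_lfun => x xI; rewrite kI // /I capvC.
(* Outside [D], any lift of [S] through [t] will do. *)
pose D := (limg j + lker t')%VS.
(* [r] is a section of [t : H -> t H]. *)
pose r := (projv H \o (t \o projv H)^-1)%VF.
have rH x : r x \in H by rewrite comp_lfunE memv_proj.
have rK x : x \in (t @: H)%VS -> t (r x) = x.
  move=> xtH; rewrite /r comp_lfunE -[LHS]comp_lfunE limg_lfunVK //.
  by rewrite limg_comp limg_proj.
have [g [gD gC]] : exists g : 'Hom(B, V),
    {in D, g =1 g1} /\ {in (D^C)%VS, g =1 (r \o S)%VF}.
  by apply: glue_lfun => x; rewrite capv_compl memv0 => /eqP ->; rewrite !linear0.
have gj x : x \in limg j -> g x = q x.
  move=> xj; rewrite gD ?g1j //; exact: (subvP (addvSl _ _)).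
have gk x : x \in lker t' -> g x = k x.
  move=> xj; rewrite gD ?g1k //; exact: (subvP (addvSr _ _)).
have split_D x : exists a y z,
    [/\ x = j a + y + z, y \in lker t' & z \in (D^C)%VS].
  have : x \in (D + D^C)%VS by rewrite addv_complf memvf.
  case/memv_addP=> _ /memv_addP[_ /memv_imgP[a _ ->] [y yk ->]] [z zD ->].
  by exists a, y, z.
have kin y : y \in lker t' -> k y \in (H :&: lker t)%VS.
  by move=> yk; rewrite -kP memv_img.
have tg x : t (g x) = S x.
  have [a [y [z [-> yk zD]]]] := split_D x.
  rewrite !linearD /= (gC z) // (gj (j a)) ?memv_img ?memvf // (gk y) // qE.
  congr (_ + _ + _).
  - by rewrite tfE /S comp_lfunE tjE qE.
  - have /memv_capP[_] := kin _ yk; rewrite memv_ker => /eqP ->.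
    by move: yk; rewrite memv_ker /S comp_lfunE => /eqP ->; rewrite linear0.
  - by rewrite comp_lfunE rK ?StH.
have gjE x : g (j x) = f x by rewrite gj ?qE // memv_img ?memvf.
have gH x : g x \in H.
  have [a [y [z [-> yk zD]]]] := split_D x.
  rewrite !linearD /= gjE (gC z) // (gk y) // !rpredD //.
  - by apply: (subvP tH); rewrite -if_ memv_img ?memvf.
  - by have /memv_capP[] := kin _ yk.
  - by rewrite comp_lfunE rH.
have kg : lker g = 0%VS.
  apply/eqP; rewrite -subv0; apply/subvP => x; rewrite memv_ker => /eqP gx.
  have xk : x \in lker t' by rewrite memv_ker SE // -tg gx linear0.
  suff: x \in (lker t' :&: lker k)%VS.
    suff -> : (lker t' :&: lker k)%VS = 0%VS by [].
    apply/eqP; rewrite -dimv_eq0.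
    rewrite -(eqn_add2r (\dim (k @: lker t')%VS)) limg_ker_dim kP add0n.
    rewrite -(eqn_add2r (\dim (t @: H)%VS)) limg_ker_dim.
    by rewrite -dA -dBH -(limg_ker_dim t' fullv) capvC capvf.
  by rewrite memv_cap xk memv_ker -gk // gx /=.
exists g; split=> //.
- apply/eqP; rewrite eqEdim; apply/andP; split.
    by apply/subvP => _ /memv_imgP[x _ ->].
  by rewrite dim_limg_inj // dBH.
- apply/lfunP => x; rewrite !comp_lfunE tg /S comp_lfunE.
  by case: (jt' x) => a ->; rewrite qE gjE.
- by apply/lfunP => x; rewrite comp_lfunE gjE.
Qed.

Lemma ex_lfun A B (h : A -> B) : linear h -> exists f : 'Hom(A, B), f =1 h.
Proof.
move=> hL.
pose h' := HB.pack_for {linear A -> B} h (GRing.isLinear.Build _ _ _ _ h hL).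
by exists (linfun h') => x; rewrite lfunE.
Qed.

Lemma ex_lfun_ker V C (H : {vspace V}) :
  \dim {:V} = (\dim H + \dim {:C})%N ->
  exists g : 'Hom(V, C), lker g = H /\ limg g = fullv.
Proof.
move=> dV; have [h hH] : exists h : 'Hom(V, C), (h @: H^C)%VS = fullv.
  by apply: ex_lfun_img; rewrite dimv_compl dV addKn.
pose g := (h \o (\1 - projv H))%VF.
have gE x : g x = h (x - projv H x).
  by rewrite comp_lfunE add_lfunE opp_lfunE id_lfunE.
have ig : limg g = fullv.
  apply/vspaceP => y; rewrite memvf.
  have : y \in (h @: H^C)%VS by rewrite hH memvf.
  case/memv_imgP => z zH ->; suff -> : h z = g z by rewrite memv_img ?memvf.
  by move: zH; rewrite gE -lker_proj memv_ker => /eqP ->; rewrite subr0.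
exists g; split=> //; apply/esym/eqP; rewrite eqEdim; apply/andP; split.
  by apply/subvP => x xH; rewrite memv_ker gE projv_id // subrr linear0.
by rewrite -(leq_add2r (\dim (limg g))) -{1}(capfv (lker g)) limg_ker_dim ig dV.
Qed.

Lemma short_exact_retraction A V C (f : 'Hom(A, V)) (g : 'Hom(V, C))
    (c : 'Hom(C, V)) :
  short_exact f g -> (g \o c = \1)%VF ->
  exists r : 'Hom(V, A), biproduct f c r g.
Proof.
case=> kf ifg ig gc1.
have fK : cancel f f^-1%VF by apply: lker0_lfunK; rewrite kf.
have gc x : g (c x) = x by rewrite -comp_lfunE gc1 id_lfunE.
have gf x : g (f x) = 0.
  by apply/eqP; rewrite -memv_ker -ifg memv_img ?memvf.
exists (f^-1 \o (\1 - (c \o g)))%VF.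
have pE x : ((\1%VF : 'End(V)) - (c \o g)%VF) x = x - c (g x).
  by rewrite add_lfunE opp_lfunE id_lfunE comp_lfunE.
split; apply/lfunP => x; rewrite ?add_lfunE !comp_lfunE ?pE ?id_lfunE ?zero_lfunE.
- by rewrite gf linear0 subr0 fK.
- by rewrite gc.
- by rewrite gc subrr linear0.
- by rewrite gf.
- by rewrite limg_lfunVK ?subrK // ifg memv_ker linearB /= gc subrr.
Qed.

Lemma short_exact_split A V C (f : 'Hom(A, V)) (g : 'Hom(V, C)) :
  short_exact f g ->
  exists (c : 'Hom(C, V)) (r : 'Hom(V, A)), biproduct f c r g.
Proof.
move=> fg; have [_ _ ig] := fg; exists (g^-1)%VF.
apply: short_exact_retraction => //; apply/lfunP => x.
by rewrite comp_lfunE id_lfunE limg_lfunVK // ig memvf.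
Qed.

Lemma biproduct_exchangeK A V V' C (f : 'Hom(A, V)) (c : 'Hom(C, V)) r g
    (f' : 'Hom(A, V')) (c' : 'Hom(C, V')) r' g' :
  biproduct f c r g -> biproduct f' c' r' g' ->
  (((f \o r')%VF + (c \o g')%VF) \o ((f' \o r)%VF + (c' \o g)%VF) = \1)%VF.
Proof.
case=> _ _ _ _ <- [rf gc rc gf _].
rewrite comp_lfunDl !comp_lfunDr -!comp_lfunA.
rewrite (comp_lfunA r') rf (comp_lfunA r' c') rc (comp_lfunA g') gf.
rewrite (comp_lfunA g' c') gc !comp_lfun0l !comp_lfun0r !comp_lfun1l.
by rewrite addr0 add0r.
Qed.

Lemma dim_Hom A B : \dim {:'Hom(A, B)} = (\dim {:A} * \dim {:B})%N.
Proof. by rewrite !dimvf. Qed.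

(** * Counting endomorphisms of an extension *)

(** An extension of [(C, 0)] by [(A, s)] with middle term [(V, t)], split as a
    sequence of vector spaces.  [E] and [F] stand for the endomorphism algebras
    of the sub-object and of the middle term. *)
Section ExtensionEndomorphisms.
Variables (A V C : vectType K).
Variables (f : 'Hom(A, V)) (c : 'Hom(C, V)) (r : 'Hom(V, A)) (g : 'Hom(V, C)).
Hypothesis fcrg : biproduct f c r g.
Variables (s : 'End(A)) (t : 'End(V)).
Hypothesis tf : (t \o f = f \o s)%VF.
Hypothesis gt : (g \o t = 0)%VF.
Variables (E : {vspace 'End(A)}) (F : {vspace 'End(V)}).

Let rf x : r (f x) = x.
Proof. by case: fcrg => /lfunP/(_ x); rewrite comp_lfunE id_lfunE. Qed.

Let gc x : g (c x) = x.
Proof. by case: fcrg => _ /lfunP/(_ x); rewrite comp_lfunE id_lfunE. Qed.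

Let rc x : r (c x) = 0.
Proof. by case: fcrg => _ _ /lfunP/(_ x); rewrite comp_lfunE zero_lfunE. Qed.

Let gf x : g (f x) = 0.
Proof. by case: fcrg => _ _ _ /lfunP/(_ x); rewrite comp_lfunE zero_lfunE. Qed.

Let fcE x : f (r x) + c (g x) = x.
Proof.
case: fcrg => _ _ _ _ /lfunP/(_ x).
by rewrite add_lfunE !comp_lfunE id_lfunE.
Qed.

Let tfE x : t (f x) = f (s x).
Proof. by rewrite -comp_lfunE tf comp_lfunE. Qed.

Let gtE x : g (t x) = 0.
Proof. by rewrite -comp_lfunE gt zero_lfunE. Qed.

Let f_inj : lker f = 0%VS.
Proof. by apply/eqP/lker0P => x y /(congr1 r); rewrite !rf. Qed.

Lemma dim_biproduct : \dim {:V} = (\dim {:A} + \dim {:C})%N.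
Proof.
rewrite -(limg_ker_dim g fullv) capfv.
have -> : lker g = limg f.
  apply/vspaceP => x; rewrite memv_ker; apply/eqP/memv_imgP => [gx|[a _ ->]] //.
  by exists (r x); rewrite ?memvf // -{1}[x]fcE gx linear0 addr0.
rewrite dim_limg_inj //; congr (_ + \dim _)%N.
by apply/vspaceP => x; rewrite memvf -[x]gc memv_img ?memvf.
Qed.

Let dim_ker_t : (limg t = limg f)%VS -> \dim (lker t) = \dim {:C}.
Proof.
move=> tV; apply/eqP; rewrite -(eqn_add2r (\dim (limg t))).
rewrite -[in X in X == _](capfv (lker t)) limg_ker_dim.
rewrite dim_biproduct tV dim_limg_inj //.
by rewrite addnC.
Qed.

(** Restricting an endomorphism to [limg f] maps [F] to [E].  An endomorphism
    that restricts to [0] vanishes on [limg t], hence takes its values in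
    [ker t]; it amounts to a map from [C] to [ker t], whose dimension is
    that of [C]. *)
Lemma dim_End_extension_le :
  (limg t = limg f)%VS ->
  (forall u, u \in F -> (t \o u = u \o t)%VF) ->
  (forall u, u \in F -> exists2 v, v \in E & (u \o f = f \o v)%VF) ->
  (\dim F <= \dim E + \dim {:C} * \dim {:C})%N.
Proof.
move=> tV Ft FE.
have [rho rhoE] : exists rho : 'Hom('End(V), 'End(A)),
    rho =1 (fun u => r \o (u \o f))%VF.
  apply: ex_lfun => a u v /=.
  by rewrite comp_lfunDl comp_lfunDr -comp_lfunZl -comp_lfunZr.
pose P := linfun (vsproj (lker t)).
have [sig sigE] : exists sig : 'Hom('End(V), 'Hom(C, subvs_of (lker t))),
    sig =1 (fun u => P \o (u \o c))%VF.
  apply: ex_lfun => a u v /=.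
  by rewrite comp_lfunDl comp_lfunDr -comp_lfunZl -comp_lfunZr.
rewrite -(limg_ker_dim rho F) addnC leq_add //.
  apply/dimvS/subvP => _ /memv_imgP[u uF ->]; rewrite rhoE.
  case: (FE _ uF) => v vE ->; rewrite comp_lfunA.
  by case: fcrg => -> *; rewrite comp_lfun1l.
rewrite -[X in (_ * X)%N]dim_ker_t //.
have -> : \dim (lker t) = \dim {:subvs_of (lker t)} by rewrite dimvf.
rewrite -dim_Hom -(limg_dim_eq (f := sig)) ?dimvS ?subvf //.
apply/eqP; rewrite -subv0; apply/subvP => u.
move=> /memv_capP[/memv_capP[uF]]; rewrite !memv_ker rhoE sigE => /eqP ru /eqP su.
have uf x : u (f x) = 0.
  case: (FE _ uF) => v vE uv; rewrite -comp_lfunE uv comp_lfunE.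
  move/lfunP/(_ x): ru; rewrite !comp_lfunE zero_lfunE -(comp_lfunE u) uv.
  by rewrite comp_lfunE rf => ->; rewrite linear0.
rewrite memv0; apply/eqP/lfunP => x; rewrite zero_lfunE.
rewrite -[x]fcE linearD /= uf add0r.
have uk : u (c (g x)) \in lker t.
  rewrite memv_ker -(comp_lfunE t u) Ft // comp_lfunE.
  have : t (c (g x)) \in limg f by rewrite -tV memv_img ?memvf.
  by case/memv_imgP => a _ ->; rewrite uf.
move/lfunP/(_ (g x)): su; rewrite !comp_lfunE zero_lfunE lfunE /=.
by move/(congr1 vsval); rewrite vsprojK.
Qed.

(** [t] induces a surjection from [V / t V], of dimension [\dim C], onto
    [t V / t^2 V], which is [A / s A]. *)
Lemma dim_cokernel_le :
  (limg t = limg f)%VS -> (\dim {:A} <= \dim (limg s) + \dim {:C})%N.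
Proof.
move=> tV.
have -> : \dim (limg s) = \dim (t @: limg t)%VS.
  rewrite tV -limg_comp -(dim_limg_inj (limg s) f_inj) -limg_comp.
  by rewrite tf.
rewrite -(dim_limg_inj fullv f_inj) -tV -(limg_ker_dim t (limg t)) addnC.
by rewrite leq_add2l -dim_ker_t // dimvS // capvSr.
Qed.

(** With respect to the splitting, [t] is given by [s] and a gluing map
    [e : C -> A].  A block triangular map, with [v] in [E] and [d : C -> C] on
    the diagonal and [b : C -> A] above it, commutes with [t] as soon as
    [D (v, b, d) := v e - s b - e d] vanishes.  As [D] takes its values in
    [Hom(C, A)], its kernel has dimension at least [\dim E + \dim C ^ 2], and
    if [F] is no larger then [D] is surjective.  This forces
    [s A + e C = A], that is [t V = limg f]: otherwise, [C] being at least as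
    large as the cokernel of [s], some nonzero [y] has [e y] in [s A]; then
    every map in the image of [D] sends [y] into the proper subspace
    [s A + e C]. *)
Lemma dim_End_extension_ge :
  (forall v, v \in E -> (s \o v = v \o s)%VF) ->
  (forall u v, v \in E -> (u \o f = f \o v)%VF -> (t \o u = u \o t)%VF ->
     u \in F) ->
  (\dim F <= \dim E + \dim {:C} * \dim {:C})%N ->
  (\dim {:A} <= \dim (limg s) + \dim {:C})%N ->
  (limg t = limg f)%VS.
Proof.
move=> Es EF dF dA.
pose e := (r \o (t \o c))%VF.
have tc x : t (c x) = f (e x).
  by rewrite /e !comp_lfunE -[LHS]fcE gtE linear0 addr0.
clearbody e.
pose T : vectType K := (subvs_of E * ('Hom(C, A) * 'End(C)))%type.
pose Dfun (w : T) : 'Hom(C, A) :=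
  (vsval w.1 \o e)%VF - (s \o w.2.1)%VF - (e \o w.2.2)%VF.
pose Pfun (w : T) : 'End(V) :=
  (f \o (vsval w.1 \o r))%VF + (f \o (w.2.1 \o g))%VF + (c \o (w.2.2 \o g))%VF.
have [D DE] : exists D : 'Hom(T, 'Hom(C, A)), D =1 Dfun.
  apply: ex_lfun => a w w'; rewrite /Dfun linearP /=.
  rewrite !(comp_lfunDl, comp_lfunDr) -!(comp_lfunZl, comp_lfunZr).
  by rewrite !scalerBr !opprD [X in X + _]addrACA [LHS]addrACA.
have [P PE] : exists P : 'Hom(T, 'End(V)), P =1 Pfun.
  apply: ex_lfun => a w w'; rewrite /Pfun linearP /=.
  rewrite !(comp_lfunDl, comp_lfunDr) -!(comp_lfunZl, comp_lfunZr).
  by rewrite !scalerDr [X in X + _]addrACA [LHS]addrACA.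
have kP : lker P = 0%VS.
  apply/eqP; rewrite -subv0; apply/subvP => -[v [b d]].
  rewrite memv_ker PE /Pfun /= memv0 => /eqP/lfunP P0.
  have v0 : v = 0.
    apply: val_inj; apply/lfunP => x; move: (P0 (f x)).
    rewrite !(add_lfunE, comp_lfunE) gf !linear0 !addr0 rf zero_lfunE.
    by move/(congr1 r); rewrite rf linear0 => ->; rewrite zero_lfunE.
  have Pc x : f (b x) + c (d x) = 0.
    move: (P0 (c x)); rewrite !(add_lfunE, comp_lfunE) rc gc !linear0 add0r.
    by rewrite zero_lfunE.
  have -> : b = 0.
    apply/lfunP => x; move/(congr1 r): (Pc x).
    by rewrite linearD /= rf rc addr0 linear0 zero_lfunE.
  have -> : d = 0.
    apply/lfunP => x; move/(congr1 g): (Pc x).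
    by rewrite linearD /= gf gc add0r linear0 zero_lfunE.
  by rewrite v0.
have PF : (P @: lker D <= F)%VS.
  apply/subvP => _ /memv_imgP[[v [b d]] kD ->]; rewrite PE.
  move: kD; rewrite memv_ker DE => /eqP/lfunP kD.
  have vE := subvsP v.
  have svE x : s (vsval v x) = vsval v (s x).
    by rewrite -comp_lfunE Es // comp_lfunE.
  apply: (EF _ (vsval v)) => //; apply/lfunP => x.
    by rewrite !(add_lfunE, comp_lfunE) /= gf !linear0 !addr0 rf.
  rewrite comp_lfunE [RHS]comp_lfunE !(add_lfunE, comp_lfunE) /=.
  rewrite gtE !linear0 !addr0 !linearD /= !tfE tc svE -!linearD /=.
  congr (f _).
  have -> : r (t x) = s (r x) + e (g x).
    by rewrite -{1}[x]fcE linearD /= tfE tc linearD /= !rf.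
  rewrite [in RHS]linearD -addrA; congr (_ + _); apply/eqP.
  rewrite eq_sym -subr_eq0 opprD addrA; apply/eqP.
  move: (kD (g x)); rewrite /Dfun /=.
  by rewrite !(add_lfunE, opp_lfunE, comp_lfunE) zero_lfunE.
have Dfull : limg D = fullv.
  apply/eqP; rewrite eqEdim subvf /=.
  have dT : \dim {:T} = (\dim E + (\dim {:'Hom(C, A)} + \dim {:C} * \dim {:C}))%N.
    by rewrite -dim_Hom !dimvf.
  have := leq_trans (dimvS PF) dF; rewrite dim_limg_inj //.
  have := limg_ker_dim D fullv; rewrite capfv dT => dk kle.
  rewrite -(leq_add2l (\dim (lker D))) dk addnCA addnC.
  by rewrite leq_add2l.
have sub_tf : (limg t <= limg f)%VS.
  apply/subvP => _ /memv_imgP[x _ ->].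
  by rewrite -[t x]fcE gtE linear0 addr0 memv_img ?memvf.
have full : (limg s + limg e)%VS = fullv.
  apply/eqP; apply: contraT => nfull.
  have [x _ xS] : exists2 x, x \in {:A}%VS & x \notin (limg s + limg e)%VS.
    by apply/subvPn; apply: contra nfull => fS; rewrite eqEsubv subvf.
  have [y yS y0] : exists2 y, e y \in limg s & y != 0.
    exists (vpick (e @^-1: limg s)%VS).
      by rewrite memv_preim memv_pick.
    rewrite vpick0; apply: contra nfull => /eqP pre0.
    have ke : lker e = 0%VS.
      apply/eqP; rewrite -subv0 -pre0; apply/subvP => z.
      by rewrite memv_ker -memv_preim => /eqP ->; rewrite mem0v.
    have cap0 : (limg s :&: limg e)%VS = 0%VS.
      apply/eqP; rewrite -subv0; apply/subvP => z.
      case/memv_capP=> zs /memv_imgP[w _ zw]; move: zs.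
      rewrite zw memv_preim pre0.
      by rewrite !memv0 => /eqP ->; rewrite linear0.
    by rewrite eqEdim subvf dimv_disjoint_sum // (dim_limg_inj _ ke).
  have [h hy] : exists h : 'Hom(C, A), h y = x.
    have [h hP] := linear_of_free [:: y] [:: x].
    exists (linfun h); rewrite lfunE; move: hP; rewrite seq1_free => hP.
    by case: (hP y0 erefl).
  have : h \in limg D by rewrite Dfull memvf.
  case/memv_imgP => [[v [b d]] _ hE].
  rewrite -(negPf xS) -hy hE DE /Dfun /=.
  rewrite !(add_lfunE, opp_lfunE, comp_lfunE).
  case/memv_imgP: yS => z _ ->.
  have -> : vsval v (s z) = s (vsval v z).
    by rewrite -!comp_lfunE Es // subvsP.
  by rewrite -linearB -(linearN e) memv_add ?memv_img ?memvf.
apply: subv_anti; rewrite sub_tf /=; apply/subvP => _ /memv_imgP[a _ ->].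
have : a \in (limg s + limg e)%VS by rewrite full memvf.
case/memv_addP => _ /memv_imgP[y _ ->] [_ /memv_imgP[z _ ->] ->].
by rewrite linearD /= -tfE -tc -linearD memv_img ?memvf.
Qed.

End ExtensionEndomorphisms.

End LinearAlgebra.

(** * Jordan form of a nilpotent operator *)

Section Jordan.
Variable K : fieldType.
Implicit Types V : vectType K.

Local Notation Q n := {poly %/ ('X^n : {poly K})}.

Lemma qpoly_eq n (x y : Q n) :
  (forall i, (x : {poly K})`_i = (y : {poly K})`_i) -> x = y.
Proof. by move=> xy; apply: val_inj; apply/polyP. Qed.

Lemma coef_in_qpolyXn n (p : {poly K}) i : (0 < n)%N ->
  (in_qpoly 'X^n p)`_i = if (i < n)%N then p`_i else 0.
Proof.
move=> n0; rewrite /in_qpoly /= mk_monic_Xn prednK //.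
rewrite -[in LHS](poly_take_drop n p) addrC.
rewrite Pdiv.RingMonic.rmodp_addl_mul_small ?monicXn ?coef_take_poly //.
by rewrite size_polyXn ltnS size_take_poly.
Qed.

Lemma coef_mulX_qpoly n (x : Q n) i : (0 < n)%N ->
  (in_qpoly 'X^n 'X * x : Q n)`_i =
    if (i < n)%N then ('X * x : {poly K})`_i else 0.
Proof.
move=> n0; have {1}<- : in_qpoly 'X^n x = x.
  by apply: val_inj; rewrite [LHS]in_qpoly_small ?size_mk_monic.
rewrite -rmorphM.
exact: coef_in_qpolyXn.
Qed.

Lemma Tend_cons n l (x : N K (n :: l)) :
  Tend K (n :: l) x = (in_qpoly 'X^n 'X * (x.1 : Q n), Tend K l x.2).
Proof. by rewrite !lfunE. Qed.

Lemma Tend_nseq1 k : Tend K (nseq k 1%N) = 0.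
Proof.
apply/lfunP => x; rewrite lfunE zero_lfunE /=; elim: k x => [|k IHk] x /=.
  by rewrite [LHS]thinmx0 [RHS]thinmx0.
rewrite IHk; apply/pair_equal_spec; split => //=.
apply: qpoly_eq => i; rewrite coef_mulX_qpoly // coef0.
by case: i => // ; rewrite coefXM.
Qed.

(** [T N_m] is [N_l] when [m] is [l] with every part increased by one, followed
    by parts equal to [1]: multiplication by [T] identifies [K[T]/(T^n)] with
    [T K[T]/(T^(n+1))]. *)
Lemma shift_Jordan (l : seq nat) k : 0%N \notin l ->
  exists j : 'Hom(N K l, N K (map S l ++ nseq k 1%N)),
  [/\ lker j = 0%VS, limg j = limg (Tend K (map S l ++ nseq k 1%N))
    & (Tend K _ \o j = j \o Tend K _)%VF].
Proof.
elim: l => [|n l IHl] /=.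
  move=> _; exists 0; split; last by rewrite comp_lfun0l comp_lfun0r.
  - by apply/eqP/lker0P => x y _; rewrite (thinmx0 x) (thinmx0 y).
  - by rewrite Tend_nseq1; apply/eqP; rewrite eqEsubv; apply/andP; split;
      apply/subvP => _ /memv_imgP[x _ ->]; rewrite zero_lfunE mem0v.
rewrite inE negb_or eq_sym -lt0n => /andP[n0 /IHl [j [kj ij tj]]].
pose h (x : N K (n :: l)) : N K (n.+1 :: (map S l ++ nseq k 1%N)) :=
  (in_qpoly ('X^(n.+1) : {poly K}) ('X * ((x.1 : Q n) : {poly K})), j x.2).
have [J JE] : exists J : 'Hom(_, _), J =1 h.
  apply: ex_lfun => a x y; apply/pair_equal_spec; split=> /=.
    by rewrite mulrDr in_qpolyD -in_qpolyZ scalerAr.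
  by rewrite linearP.
have coefJ (x : Q n) i : (in_qpoly 'X^(n.+1) ('X * x : {poly K}))`_i =
    if (i < n.+1)%N then ('X * x : {poly K})`_i else 0.
  exact: coef_in_qpolyXn.
exists J; split.
- apply/eqP/lker0P => -[x1 x2] [y1 y2]; rewrite !JE => /pair_equal_spec[/= e1 e2].
  apply/pair_equal_spec; split=> /=; last by apply: (lker0P (introT eqP kj)).
  apply: qpoly_eq => i.
  move/(congr1 (fun q : Q n.+1 => (q : {poly K})`_i.+1)): e1.
  rewrite !coefJ ltnS !coefXM /=; case: ltnP => // ni _.
  rewrite !nth_default // (leq_trans (size_npoly _)) //;
    by rewrite mk_monic_Xn size_polyXn prednK.
- apply/vspaceP => y; apply/memv_imgP/memv_imgP => -[x _ ->].
    rewrite JE /h; have : j x.2 \in limg j by rewrite memv_img ?memvf.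
    rewrite ij => /memv_imgP[z _ ->].
    exists (in_qpoly ('X^(n.+1) : {poly K}) (x.1 : Q n), z); first exact: memvf.
    by rewrite Tend_cons /= rmorphM.
  rewrite Tend_cons; have :
      Tend K _ x.2 \in limg (Tend K (map S l ++ nseq k 1%N)).
    by rewrite memv_img ?memvf.
  rewrite -ij => /memv_imgP[z _ ->].
  exists (in_qpoly ('X^n : {poly K}) (x.1 : Q n.+1), z); first exact: memvf.
  rewrite JE /h; apply/pair_equal_spec; split=> //.
  apply: qpoly_eq => i.
  rewrite coef_mulX_qpoly // coefJ; case: ltnP => // ni; rewrite !coefXM.
  case: i ni => //= i; rewrite ltnS => ni.
  by rewrite coef_in_qpolyXn // ni.
- apply/lfunP => x; rewrite !comp_lfunE !JE !Tend_cons /h.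
  apply/pair_equal_spec; split.
    apply: qpoly_eq => i.
    rewrite coef_mulX_qpoly // coefJ; case: ltnP => // ni; rewrite !coefXM.
    case: i ni => //= i; rewrite ltnS => ni.
    by rewrite coefJ coef_mulX_qpoly // ni (ltn_trans ni).
  by move/lfunP/(_ x.2): tj; rewrite !comp_lfunE.
Qed.

Lemma is_partition_shift (l : Defs.partition) k :
  is_partition (map S l ++ nseq k 1%N).
Proof.
case: l => l /= /andP[sl nl]; apply/andP; split; last first.
  by rewrite mem_cat mem_nseq andbF orbF; apply/mapP => -[].
have gt : transitive geq by move=> a b c /= ab bc; exact: leq_trans bc ab.
rewrite sorted_pairwise // pairwise_cat; apply/and3P; split.
- by apply/allrelP => x y /mapP[a _ ->]; rewrite mem_nseq => /andP[_ /eqP ->].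
- by rewrite -sorted_pairwise // sorted_map; exact: sl.
- by elim: k => //= k ->; rewrite all_nseq orbT.
Qed.

Lemma parts_neq0 (l : Defs.partition) : 0%N \notin parts l.
Proof. by case: l => ? /= /andP[]. Qed.

Lemma nilpotent_img_lt V (t : 'End(V)) (H : {vspace V}) k :
  (forall x, x \in H -> iter k t x = 0) -> (t @: H <= H)%VS -> H != 0%VS ->
  (\dim (t @: H) < \dim H)%N.
Proof.
move=> tk tH; apply: contraNT; rewrite -leqNgt => dH.
have tHH : (t @: H)%VS = H by apply/eqP; rewrite eqEdim tH.
have surj m x : x \in H -> exists2 y, y \in H & x = iter m t y.
  elim: m x => [|m IHm] x xH; first by exists x.
  have [y yH ->] := IHm _ xH; move: yH; rewrite -{1}tHH.
  by case/memv_imgP => z zH ->; exists z; rewrite -?iterSr.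
rewrite -subv0; apply/subvP => x xH; have [y yH ->] := surj k _ xH.
by rewrite tk ?mem0v.
Qed.

(** Induction on the dimension of [H]: the Jordan type [l] of [t H] determines
    a module [N_m] of the dimension of [H] with [T N_m] isomorphic to [t H]
    (lemma [shift_Jordan]), and by [extend_over_radical] that isomorphism
    extends to one between [N_m] and [H].  Working inside a fixed [V] with
    stable subspaces [H] avoids restricting operators. *)
Lemma Jordan_form V (t : 'End(V)) (H : {vspace V}) k :
  (forall x, x \in H -> iter k t x = 0) -> (t @: H <= H)%VS ->
  exists (l : Defs.partition) (f : 'Hom(N K l, V)),
  [/\ lker f = 0%VS, limg f = H & (t \o f = f \o Tend K l)%VF].
Proof.
move=> tk tH.
(* The number of parts is carried along: it bounds the number of parts of
   [t H], so that the number [n - size l] of new parts below makes sense. *)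
suff [l [f [kf ifH tf _]]] : exists (l : Defs.partition) (f : 'Hom(N K l, V)),
  [/\ lker f = 0%VS, limg f = H, (t \o f = f \o Tend K l)%VF &
    (size l + \dim (t @: H) = \dim H)%N] by exists l, f.
have [m] := ubnP (\dim H).
elim: m H tk tH => // m IHm H tk tH; rewrite ltnS => dm.
have [H0|H0] := eqVneq H 0%VS.
  exists (part1 0), 0; split=> /=.
  - by apply/eqP/lker0P => x y _; rewrite (thinmx0 x) (thinmx0 y).
  - rewrite H0; apply/eqP; rewrite -subv0; apply/subvP => _ /memv_imgP[x _ ->].
    by rewrite zero_lfunE mem0v.
  - by rewrite comp_lfun0l comp_lfun0r.
  - by rewrite H0 limg0.
have dtH := nilpotent_img_lt tk tH H0.
have [||| l [f [kf ifH tf sl]]] := IHm (t @: H)%VS.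
- by move=> x /(subvP tH); exact: tk.
- exact: limgS.
- exact: leq_trans dtH dm.
pose n := (\dim H - \dim (t @: H))%N.
have ln : (size l <= n)%N.
  rewrite leq_subRL ?dimvS // -(limg_ker_dim t H) addnC leq_add2r.
  rewrite -(leq_add2r (\dim (t @: (t @: H)))) sl.
  by rewrite -[X in (X <= _)%N](limg_ker_dim t (t @: H)) leq_add2r dimvS // capvS.
pose l' := Partition (is_partition_shift l (n - size l)).
have [j [kj ij tj]] := shift_Jordan (n - size l) (parts_neq0 l).
have dl' : \dim {:N K l'} = \dim H.
  rewrite dim_N ?parts_neq0 //.
  have : \dim {:N K l} = \dim (t @: H)%VS by rewrite -ifH dim_limg_inj.
  rewrite dim_N ?parts_neq0 // /l' /= sumn_cat sumn_nseq mul1n.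
  have -> : sumn (map S l) = (sumn l + size l)%N.
    by elim: (parts l) => //= a s ->; rewrite addSn addnS addnA.
  by move=> ->; rewrite -addnA subnKC // subnKC // dimvS.
have [g [kg ig tg _]] :=
  @extend_over_radical K _ (N K l') _ _ _ _ _ _ _ kj ij tj kf ifH tf tH dl'.
exists l', g; split=> //.
by rewrite /l' /= size_cat size_map size_nseq subnKC // subnK // dimvS.
Qed.

Lemma iter_Tend l k x : iter k (Tend K l) x = act 'X^k x.
Proof.
elim: k => [|k IHk]; first by rewrite expr0 -[1]/(1%:P) actC scale1r.
by rewrite iterS IHk lfunE /= -actM -exprS.
Qed.

Lemma Tend_nilpotent (l : Defs.partition) :
  exists k, forall x : N K l, iter k (Tend K l) x = 0.
Proof.
case: l => l lP; have /= := parts_neq0 (Partition lP) => nl.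
suff [k Hk] : exists k, forall x : N K l, act 'X^k x = 0.
  by exists k => x; rewrite iter_Tend.
elim: l nl {lP} => [|n l IHl] /=; first by exists 0%N => x; exact: thinmx0.
rewrite inE negb_or eq_sym -lt0n => /andP[n0 /IHl [k Hk]].
exists (n + k)%N => -[x1 x2]; apply/pair_equal_spec; split=> /=.
  suff -> : in_qpoly 'X^n 'X^(n + k) = 0 :> Q n by rewrite mul0r.
  apply: qpoly_eq => i; rewrite coef_in_qpolyXn // coefXn coef0.
  by case: ltnP => // ni; rewrite ltn_eqF // (leq_trans ni) // leq_addr.
by rewrite exprD actM Hk linear0.
Qed.

End Jordan.

(** * Objects as pairs of a nilpotent operator and a subspace *)

(** Since the embedding [emb X] is injective, an object is determined up to
    isomorphism by [N (amb X)], its operator and the subspace [limg (emb X)];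
    morphisms and extensions can be described in these terms. *)
Section Objects.
Variable K : fieldType.
Implicit Types V : vectType K.

Lemma semisimple_nseq (l : Defs.partition) :
  (head 0 l <= 1)%N -> parts l = nseq (size l) 1%N.
Proof.
case: l => l /= /andP[]; case: l => //= a l pl nl a1.
apply/all_pred1P => /=.
have gt : transitive geq by move=> x y z /= xy yz; exact: leq_trans yz xy.
have /allP la := order_path_min gt pl.
have ne0 b : b \in a :: l -> (0 < b)%N.
  by rewrite lt0n; apply: contraTneq => ->.
apply/andP; split; first by rewrite -[_ == _]/(a == 1)%N eqn_leq a1 ne0 ?mem_head.
apply/allP => b bl /=; rewrite eqn_leq ne0 ?inE ?bl ?orbT // andbT.
exact: leq_trans (la _ bl) a1.
Qed.

Lemma dim_part1 n : \dim {:N K (part1 n)} = n.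
Proof.
rewrite dim_N; last exact: parts_neq0.
by rewrite sumn_nseq mul1n.
Qed.

Lemma Tend_sub (Z : obj1 K) : Tend K (sub Z) = 0.
Proof. by rewrite (semisimple_nseq (obj1P Z)) Tend_nseq1. Qed.

Lemma emb_Tend (X : obj K) (x : N K (sub X)) :
  Tend K (amb X) (emb X x) = emb X (Tend K (sub X) x).
Proof. by rewrite -!comp_lfunE ((ThomE _).1 (@emb_Thom K X)). Qed.

Lemma limg_emb_ker (Z : obj1 K) : (limg (emb Z) <= lker (Tend K (amb Z)))%VS.
Proof.
apply/subvP => _ /memv_imgP[x _ ->].
by rewrite memv_ker emb_Tend Tend_sub zero_lfunE linear0.
Qed.

(** Turns a concrete pair of a stable subspace [H] and a subspace of [ker t] into
    an object, so that sub-objects can be described inside a given module. *)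
Lemma realize_obj1 V (t : 'End(V)) (H U : {vspace V}) k :
  (forall x, x \in H -> iter k t x = 0) -> (t @: H <= H)%VS ->
  (U <= H)%VS -> (U <= lker t)%VS ->
  exists (Z : obj1 K) (f : 'Hom(N K (amb Z), V)),
  [/\ lker f = 0%VS, limg f = H, (t \o f = f \o Tend K (amb Z))%VF
    & (f @: limg (emb Z))%VS = U].
Proof.
move=> tk tH UH Ut; have [l [f [kf fH tf]]] := Jordan_form tk tH.
pose W := (f @^-1: U)%VS.
have fW : (f @: W)%VS = U by rewrite lpreimK // fH.
have [e eW] : exists e : 'Hom(N K (part1 (\dim W)), N K l), limg e = W.
  by apply: ex_lfun_img; rewrite dim_part1.
have ke : lker e == 0%VS.
  rewrite -dimv_eq0 -(eqn_add2r (\dim (limg e))) -{1}(capfv (lker e)).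
  by rewrite limg_ker_dim eW add0n dim_part1.
have eT : Thom e.
  apply/ThomE; rewrite Tend_nseq1 comp_lfun0r; apply/lfunP => x.
  rewrite zero_lfunE comp_lfunE; apply: (lker0P (introT eqP kf)).
  rewrite linear0 -(comp_lfunE f) -tf comp_lfunE.
  apply/esym/eqP; rewrite -memv_ker.
  apply: (subvP Ut); have : e x \in limg e by rewrite memv_img ?memvf.
  by rewrite eW (memv_preim f).
have Z1 : (head 0 (sub (Obj eT ke)) <= 1)%N by rewrite /=; case: (\dim W).
by exists (Obj1 Z1), f; split=> //=; rewrite eW.
Qed.

Lemma mor_of_amb (X Y : obj K) (u : 'Hom(N K (amb X), N K (amb Y))) :
  (Tend K _ \o u = u \o Tend K _)%VF ->
  (u @: limg (emb X) <= limg (emb Y))%VS ->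
  exists h : mor X Y, mor2 h = u.
Proof.
move=> tu uU.
have kY : lker (emb Y) == 0%VS := emb_inj Y.
pose v := ((emb Y)^-1 \o (u \o emb X))%VF.
have vE x : emb Y (v x) = u (emb X x).
  rewrite /v !comp_lfunE limg_lfunVK //; apply: (subvP uU).
  by rewrite !memv_img ?memvf.
clearbody v; have vT : Thom v.
  apply/ThomE/lfunP => x; rewrite !comp_lfunE; apply: (lker0P kY).
  by rewrite vE -!emb_Tend vE -(comp_lfunE u) -tu comp_lfunE.
have uv : (emb Y \o v = u \o emb X)%VF.
  by apply/lfunP => x; rewrite comp_lfunE vE comp_lfunE.
by exists (Mor vT ((ThomE u).2 (esym tu)) uv).
Qed.

Lemma mor1E (X Y : obj K) (h : mor X Y) (x : N K (sub X)) :
  emb Y (mor1 h x) = mor2 h (emb X x).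
Proof. by rewrite -!comp_lfunE mor_comm. Qed.

Lemma mor_Tend (X Y : obj K) (h : mor X Y) :
  (Tend K (amb Y) \o mor2 h = mor2 h \o Tend K (amb X))%VF.
Proof. by rewrite ((ThomE _).1 (@mor2_Thom K X Y h)). Qed.

Lemma iso_of_amb (X Y : obj K) (u : 'Hom(N K (amb X), N K (amb Y))) :
  lker u = 0%VS -> limg u = fullv ->
  (Tend K _ \o u = u \o Tend K _)%VF ->
  (u @: limg (emb X) = limg (emb Y))%VS -> iso X Y.
Proof.
move=> ku iu tu uU.
have uK : cancel u u^-1%VF by apply: lker0_lfunK; rewrite ku.
have uVK x : u (u^-1%VF x) = x by rewrite limg_lfunVK // iu memvf.
have tuE x : Tend K _ (u x) = u (Tend K _ x) by rewrite -comp_lfunE tu comp_lfunE.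
have [h hu] : exists h : mor X Y, mor2 h = u by apply: mor_of_amb; rewrite ?uU.
have [h' h'u] : exists h' : mor Y X, mor2 h' = u^-1%VF.
  apply: mor_of_amb.
    by apply/lfunP => x; rewrite !comp_lfunE -[LHS]uK -tuE uVK.
  by rewrite -uU -limg_comp lker0_compVf ?ku // lim1g.
have hK : (mor1 h' \o mor1 h = \1)%VF.
  apply/lfunP => x; apply: (lker0P (emb_inj X)).
  by rewrite comp_lfunE !mor1E hu h'u uK id_lfunE.
have hK' : (mor1 h \o mor1 h' = \1)%VF.
  apply/lfunP => x; apply: (lker0P (emb_inj Y)).
  by rewrite comp_lfunE !mor1E hu h'u uVK id_lfunE.
exists h, h'; split=> //; rewrite hu h'u; apply/lfunP => x;
  by rewrite comp_lfunE ?uK ?uVK id_lfunE.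
Qed.

(** The condition on [f] says that the sub-object carries the full trace of
    [limg (emb Z)], which makes the sequence of first components exact in the
    middle. *)
Lemma extension_of_amb (X Z Y : obj K) (f : 'Hom(N K (amb X), N K (amb Z)))
    (g : 'Hom(N K (amb Z), N K (amb Y))) :
  short_exact f g ->
  (Tend K _ \o f = f \o Tend K _)%VF -> (Tend K _ \o g = g \o Tend K _)%VF ->
  (f @: limg (emb X) = limg (emb Z) :&: limg f)%VS ->
  (g @: limg (emb Z) = limg (emb Y))%VS -> extension Y X Z.
Proof.
move=> fg tf tg fU gU; have [kf fgE ig] := fg.
have [a af] : exists a : mor X Z, mor2 a = f.
  by apply: mor_of_amb => //; rewrite fU capvSl.
have [b bg] : exists b : mor Z Y, mor2 b = g.
  by apply: mor_of_amb => //; rewrite gU.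
exists a, b; rewrite af bg; split=> //; split.
- apply/eqP/lker0P => x y /(congr1 (emb Z)); rewrite !mor1E af.
  by move/(lker0P (introT eqP kf))/(lker0P (emb_inj X)).
- apply/vspaceP => x; rewrite memv_ker.
  have -> : (mor1 b x == 0) = (emb Z x \in limg f).
    rewrite fgE memv_ker -bg -mor1E; apply/eqP/eqP => [->|]; first exact: linear0.
    by rewrite -(linear0 (emb Y)); apply: (lker0P (emb_inj Y)).
  apply/memv_imgP/idP => [[y _ ->]|exf].
    by rewrite mor1E af memv_img ?memvf.
  have : emb Z x \in (f @: limg (emb X))%VS.
    by rewrite fU memv_cap exf memv_img ?memvf.
  case/memv_imgP => _ /memv_imgP[y _ ->]; rewrite -af -mor1E => e.
  by exists y; [exact: memvf|exact: (lker0P (emb_inj Z))].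
- apply/vspaceP => y; rewrite memvf; apply/memv_imgP.
  have : emb Y y \in (g @: limg (emb Z))%VS by rewrite gU memv_img ?memvf.
  case/memv_imgP => _ /memv_imgP[x _ ->]; rewrite -bg -mor1E => e.
  by exists x; [exact: memvf|exact: (lker0P (emb_inj Y))].
Qed.

(** The second component of an endomorphism determines the first, so this space
    of maps of [N (amb Z)] has the dimension of [EndS Z]. *)
Definition EndV (Z : obj K) : {vspace 'End(N K (amb Z))} :=
  (linfun snd @: EndS Z)%VS.

Lemma mem_EndV Z u :
  u \in EndV Z <-> (Tend K _ \o u = u \o Tend K _)%VF /\
    (u @: limg (emb Z) <= limg (emb Z))%VS.
Proof.
split=> [/memv_imgP[w /mem_EndS[h ->]]|[tu uU]].
  rewrite lfunE /= => ->; split; first exact: mor_Tend.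
  apply/subvP => _ /memv_imgP[_ /memv_imgP[x _ ->] ->].
  by rewrite -mor1E memv_img ?memvf.
have [h hu] := mor_of_amb tu uU.
apply/memv_imgP; exists (mor1 h, mor2 h); last by rewrite lfunE.
by apply/mem_EndS; exists h.
Qed.

Lemma dim_EndV Z : \dim (EndV Z) = \dim (EndS Z).
Proof.
apply: limg_dim_eq; apply/eqP; rewrite -subv0; apply/subvP => w.
case/memv_capP=> /mem_EndS[h ->]; rewrite memv_ker lfunE /= memv0 => /eqP h0.
apply/eqP/pair_equal_spec; split=> //=; apply/lfunP => x.
by apply: (lker0P (emb_inj Z)); rewrite mor1E h0 !zero_lfunE linear0.
Qed.

End Objects.

(** * Generic extensions by the generators *)

Section Generic.
Variable K : fieldType.

Lemma generic_extensionP (Y X Z : obj1 K) :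
  extension Y X Z -> is_generic_extension Y X (generic_extension Y X).
Proof.
move=> ZYX; apply: (xgetPex (zero_obj K) (P := is_generic_extension Y X)).
pose D d := `[< exists2 W : obj1 K, extension Y X W & \dim (EndS W) = d >].
have exD : exists d, D d by exists (\dim (EndS Z)); apply/asboolP; exists Z.
case: (ex_minnP exD) => d /asboolP[W WYX <-] dmin.
exists W; split=> // W' W'YX; apply: dmin; apply/asboolP.
by exists W'.
Qed.

Lemma extension_trace (Y X Z : obj K) (f : mor X Z) (g : mor Z Y) :
  short_exact (mor1 f) (mor1 g) -> short_exact (mor2 f) (mor2 g) ->
  (mor2 f @: limg (emb X) = limg (emb Z) :&: limg (mor2 f))%VS.
Proof.
move=> [_ fg1 _] [_ fg2 _]; apply/vspaceP => x; apply/memv_imgP/memv_capP.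
  case=> _ /memv_imgP[y _ ->] ->.
  by rewrite memv_img ?memvf // -mor1E memv_img ?memvf.
case=> /memv_imgP[y _ ->]; rewrite fg2 memv_ker -mor1E => gy.
have : y \in limg (mor1 f).
  rewrite fg1 memv_ker; apply/eqP; apply: (lker0P (emb_inj Y)).
  by rewrite linear0; apply/eqP.
case/memv_imgP => z _ ->; exists (emb X z); first by rewrite memv_img ?memvf.
by rewrite mor1E.
Qed.

(** An extension of [P11] by [X] splits in the category: as [P11] equals its own
    subspace, [limg (emb Z)] maps onto it, and any linear section with values
    in [limg (emb Z)], hence in [ker T], is a section of objects. *)
Lemma extension_P11_split (X Z : obj1 K) :
  extension (P11 K) X Z ->
  exists (f : 'Hom(N K (amb X), N K (amb Z)))
    (c : 'Hom(N K (part1 1), N K (amb Z))) (r : 'Hom(N K (amb Z), N K (amb X)))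
    (g : 'Hom(N K (amb Z), N K (part1 1))),
  [/\ biproduct f c r g, (Tend K _ \o f = f \o Tend K _)%VF,
      (Tend K _ \o c = 0)%VF, (g \o Tend K _ = 0)%VF &
      (f @: limg (emb X) = limg (emb Z) :&: limg f)%VS /\
      (limg c <= limg (emb Z))%VS].
Proof.
case=> f [g [fg1 fg2]]; have [_ _ ig1] := fg1.
pose c := (emb Z \o (mor1 g)^-1)%VF.
have cE x : c x = emb Z ((mor1 g)^-1%VF x) by rewrite comp_lfunE.
have gc : (mor2 g \o c = \1)%VF.
  apply/lfunP => x.
  by rewrite comp_lfunE cE -mor1E /= !id_lfunE limg_lfunVK // ig1 memvf.
clearbody c; have [r bip] := short_exact_retraction fg2 gc.
exists (mor2 f), c, r, (mor2 g); split=> //.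
- exact: mor_Tend.
- apply/lfunP => x; rewrite comp_lfunE cE zero_lfunE; apply/eqP.
  by rewrite -memv_ker (subvP (limg_emb_ker Z)) // memv_img ?memvf.
- by rewrite -[LHS](mor_Tend g) [X in (X \o _)%VF]Tend_nseq1 comp_lfun0l.
- split; first exact: extension_trace fg1 fg2.
  by apply/subvP => _ /memv_imgP[x _ ->]; rewrite cE memv_img ?memvf.
Qed.

Lemma extension_P11_unique (X Z Z' : obj1 K) :
  extension (P11 K) X Z -> extension (P11 K) X Z' -> iso Z Z'.
Proof.
move=> /extension_P11_split[f [c [r [g [bip tf tc gt [fU cU]]]]]].
move=> /extension_P11_split[f' [c' [r' [g' [bip' tf' tc' gt' [fU' cU']]]]]].
(* Exchanging the two splittings respects the subspaces. *)
have exchange_sub (W W' : obj1 K)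
    (h : 'Hom(N K (amb X), N K (amb W))) d q (p : 'Hom(_, N K (part1 1)))
    (h' : 'Hom(N K (amb X), N K (amb W'))) d' q' (p' : 'Hom(_, N K (part1 1))) :
    biproduct h d q p -> biproduct h' d' q' p' ->
    (limg d <= limg (emb W))%VS -> (limg d' <= limg (emb W'))%VS ->
    (h @: limg (emb X) = limg (emb W) :&: limg h)%VS ->
    (h' @: limg (emb X) = limg (emb W') :&: limg h')%VS ->
    exists2 u : 'Hom(N K (amb W), N K (amb W')),
      u = (h' \o q)%VF + (d' \o p)%VF & (u @: limg (emb W) <= limg (emb W'))%VS.
  move=> b b' dU dU' hU hU'; eexists; first by [].
  apply/subvP => _ /memv_imgP[x xU ->].
  rewrite add_lfunE !comp_lfunE rpredD //; last first.
    by rewrite (subvP dU') // memv_img ?memvf.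
  have : x - d (p x) \in (h @: limg (emb X))%VS.
    case: b => _ _ _ _ /lfunP/(_ x).
    rewrite add_lfunE !comp_lfunE id_lfunE => xE.
    rewrite hU memv_cap rpredB //=; last by rewrite (subvP dU) // memv_img ?memvf.
    by rewrite -{1}xE addrK memv_img ?memvf.
  case/memv_imgP => y yU yE.
  have -> : q x = y.
    case: b => /lfunP/(_ y) + _ /lfunP/(_ (p x)) + _.
    rewrite !comp_lfunE id_lfunE zero_lfunE => <- qd.
    by rewrite -yE linearB /= qd subr0.
  have : h' y \in (h' @: limg (emb X))%VS by rewrite memv_img.
  by rewrite hU' => /memv_capP[].
have [u uE uU] := exchange_sub _ _ _ _ _ _ _ _ _ _ bip bip' cU cU' fU fU'.
have [v vE vU] := exchange_sub _ _ _ _ _ _ _ _ _ _ bip' bip cU' cU fU' fU.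
have uv : (u \o v = \1)%VF by rewrite uE vE; exact: biproduct_exchangeK.
have vu : (v \o u = \1)%VF by rewrite uE vE; exact: biproduct_exchangeK.
apply: (@iso_of_amb _ _ _ u).
- apply/eqP/lker0P => x y /(congr1 v).
  by rewrite -!(comp_lfunE v u) vu !id_lfunE.
- apply/vspaceP => x; rewrite memvf -[x]id_lfunE -uv comp_lfunE.
  by rewrite memv_img ?memvf.
- have tE (W : obj1 K) (f1 : 'Hom(N K (amb X), N K (amb W))) c1 r1
      (g1 : 'Hom(_, N K (part1 1))) : biproduct f1 c1 r1 g1 ->
      (Tend K _ \o f1 = f1 \o Tend K _)%VF -> (Tend K _ \o c1 = 0)%VF ->
      (Tend K (amb W) = f1 \o (Tend K _ \o r1))%VF.
    case=> _ _ _ _ e1 tf1 tc1; rewrite -[LHS]comp_lfun1r -e1 comp_lfunDr.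
    by rewrite !comp_lfunA tc1 comp_lfun0l addr0 tf1.
  rewrite (tE _ _ _ _ _ bip tf tc) (tE _ _ _ _ _ bip' tf' tc') uE.
  rewrite comp_lfunDl comp_lfunDr -!comp_lfunA.
  case: bip' => rf' _ rc' _ _; case: bip => rf _ _ gf _.
  rewrite (comp_lfunA r' f') rf' (comp_lfunA r' c') rc'.
  rewrite (comp_lfunA r f) rf (comp_lfunA g f) gf.
  by rewrite !(comp_lfun0l, comp_lfun0r, comp_lfun1l) !addr0.
- apply: subv_anti; rewrite uU /= -{1}[limg (emb Z')]lim1g -uv limg_comp.
  by rewrite limgS.
Qed.

Lemma extension_P0_amb (X Z : obj1 K) n :
  extension (P01_sum K n) X Z ->
  exists (f : 'Hom(N K (amb X), N K (amb Z)))
    (g : 'Hom(N K (amb Z), N K (part1 n))),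
  [/\ short_exact f g, (Tend K _ \o f = f \o Tend K _)%VF,
      (g \o Tend K _ = 0)%VF & (f @: limg (emb X) = limg (emb Z))%VS].
Proof.
case=> f [g [fg1 fg2]]; exists (mor2 f), (mor2 g); split=> //.
- exact: mor_Tend.
- by rewrite -[LHS](mor_Tend g) [X in (X \o _)%VF]Tend_nseq1 comp_lfun0l.
- rewrite (extension_trace fg1 fg2); apply/capv_idPl.
  apply/subvP => _ /memv_imgP[x _ ->]; case: fg2 => _ -> _.
  by rewrite memv_ker -mor1E /= zero_lfunE.
Qed.

(** If [T N (amb Z)] is the image of [X], the object [Z] attains the lower bound
    [\dim End(X) + n ^ 2] for the dimension of the endomorphism ring of an
    extension.  A minimal extension [Z'] then attains it too, so its radical is
    again the image of [X]; the identity of [X] extends to an isomorphism of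
    the ambient modules, which preserves the subspaces because both are images
    of [limg (emb X)]. *)
Lemma radical_extension_generic (X Z Z' : obj1 K) n :
  extension (P01_sum K n) X Z ->
  \dim (limg (Tend K (amb Z))) = \dim {:N K (amb X)} ->
  is_generic_extension (P01_sum K n) X Z' -> iso Z' Z.
Proof.
move=> extZ dT [extZ' minZ'].
have /minZ' dle := extZ; rewrite -!dim_EndV in dle.
have [f [g [fg tf gt fU]]] := extension_P0_amb extZ.
have [f' [g' [fg' tf' gt' fU']]] := extension_P0_amb extZ'.
have [c [r bip]] := short_exact_split fg.
have [c' [r' bip']] := short_exact_split fg'.
have [kf fgE _] := fg; have [kf' fgE' _] := fg'.
have fK : cancel f f^-1%VF by apply: lker0_lfunK; rewrite kf.
have tV : limg (Tend K (amb Z)) = limg f.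
  apply/eqP; rewrite eqEdim dT (dim_limg_inj _ kf) leqnn andbT fgE.
  apply/subvP => _ /memv_imgP[x _ ->].
  by rewrite memv_ker -comp_lfunE gt zero_lfunE.
have dZ : (\dim (EndV Z) <=
    \dim (EndV X) + \dim {:N K (part1 n)} * \dim {:N K (part1 n)})%N.
  apply: (dim_End_extension_le bip tV) => u /mem_EndV[tu uU] //.
  pose v := (f^-1 \o (u \o f))%VF.
  have vE x : f (v x) = u (f x).
    rewrite /v !comp_lfunE limg_lfunVK // -tV.
    have : f x \in limg (Tend K (amb Z)) by rewrite tV memv_img ?memvf.
    case/memv_imgP => y _ ->; rewrite -(comp_lfunE u) -tu comp_lfunE.
    by rewrite memv_img ?memvf.
  clearbody v.
  have tfE x : Tend K _ (f x) = f (Tend K _ x).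
    by rewrite -comp_lfunE tf comp_lfunE.
  exists v; last by apply/lfunP => x; rewrite !comp_lfunE vE.
  apply/mem_EndV; split.
    apply/lfunP => x; apply: (can_inj fK).
    by rewrite !comp_lfunE vE -!tfE vE -[RHS]comp_lfunE -tu comp_lfunE.
  rewrite -(limg_ker0 _ _ (introT eqP kf)) fU.
  apply/subvP => _ /memv_imgP[_ /memv_imgP[x xU ->] ->].
  by rewrite vE (subvP uU) // memv_img // -fU memv_img.
have tV' : limg (Tend K (amb Z')) = limg f'.
  apply: (dim_End_extension_ge bip' tf' gt' (E := EndV X) (F := EndV Z')).
  - by move=> v /mem_EndV[].
  - move=> u v /mem_EndV[tv vU] uv tu; apply/mem_EndV; split=> //.
    by rewrite -fU' -limg_comp uv limg_comp limgS.
  - exact: leq_trans dle dZ.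
  - exact: (dim_cokernel_le bip tf tV).
have [||h [kh ih th hf]] :=
    extend_over_radical kf' (esym tV') tf' kf (H := fullv) _ tf (subvf _).
- by rewrite tV.
- by rewrite (dim_biproduct bip) (dim_biproduct bip').
by apply: (iso_of_amb kh ih th); rewrite -fU' -limg_comp hf.
Qed.

(** A vector [u] of the subspace outside [limg T] spans a copy of [P11].  The
    sub-object is cut out by a hyperplane [H] that contains [limg T], hence is
    stable, and misses [u]. *)
Lemma peel_P11 (Z : obj1 K) :
  ~~ (limg (emb Z) <= limg (Tend K (amb Z)))%VS ->
  exists2 X : obj1 K, (\dim {:N K (amb X)} < \dim {:N K (amb Z)})%N &
    extension (P11 K) X Z.
Proof.
move=> /subvPn[u uU uT].
set V := N K (amb Z) in u uU uT *; set t := Tend K (amb Z) in uT *.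
pose L := (limg t + <[u]>)%VS; pose H := (limg t + L^C)%VS.
have u0 : u != 0 by apply: contraNneq uT => ->; rewrite mem0v.
have cap1 : (limg t :&: <[u]>)%VS = 0%VS.
  apply/eqP; rewrite -subv0; apply/subvP => x /memv_capP[xt /vlineP[k xk]].
  have [k0|k0] := eqVneq k 0; first by rewrite xk k0 scale0r mem0v.
  by case/negP: uT; rewrite -[u]scale1r -(mulVf k0) -scalerA -xk rpredZ.
have cap2 : (limg t :&: L^C)%VS = 0%VS.
  by apply/eqP; rewrite -subv0 -(capv_compl L) capvS // addvSl.
have uH : u \notin H.
  apply/negP => /memv_addP[a at_ [b bL uab]]; case/negP: uT.
  suff b0 : b = 0 by rewrite uab b0 addr0.
  apply/eqP; rewrite -memv0 -(capv_compl L) memv_cap bL andbT.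
  rewrite -[b](addKr a) -uab rpredD ?rpredN //.
    exact: (subvP (addvSl _ _)).
  by apply: (subvP (addvSr _ _)); exact: memv_line.
have dH : \dim {:V} = (\dim H + \dim {:N K (part1 1)})%N.
  rewrite dim_part1 dimv_disjoint_sum // dimv_compl addnAC.
  have <- : \dim L = (\dim (limg t) + 1)%N.
    by rewrite dimv_disjoint_sum // dim_vline u0.
  by rewrite subnKC // dimvS // subvf.
have [g [kg ig]] := ex_lfun_ker dH.
have [k tk] := Tend_nilpotent K (amb Z).
have tH : (limg t <= H)%VS by exact: addvSl.
have [||||X [f [kf fH tf fU]]] := @realize_obj1 K V t H (limg (emb Z) :&: H)%VS k.
- by move=> x _; exact: tk.
- by apply: subv_trans tH; rewrite limgS ?subvf.
- exact: capvSr.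
- by apply: subv_trans (limg_emb_ker Z); exact: capvSl.
exists X.
  by rewrite -(dim_limg_inj fullv kf) fH dH dim_part1 addn1.
apply: (@extension_of_amb K X Z (P11 K) f g) => //.
- by split; rewrite ?fH ?kg.
- rewrite [X in (X \o _)%VF]Tend_nseq1 comp_lfun0l; apply/lfunP => x.
  rewrite zero_lfunE comp_lfunE; apply/esym/eqP; rewrite -memv_ker kg.
  by rewrite (subvP tH) // memv_img ?memvf.
- by rewrite fH.
- apply/eqP; rewrite eqEdim; apply/andP; split.
    by apply/subvP => x _; rewrite -[x]id_lfunE memv_img ?memvf.
  apply: (@leq_trans 1%N).
    by rewrite -(dim_part1 K 1) dimvS // subvf.
  rewrite lt0n dimv_eq0; apply: contra uH => /eqP gU.
  by rewrite -kg memv_ker -memv0 -gU memv_img.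
Qed.

(** The sub-object is [limg T] with the same subspace; [T] acts as zero on the
    quotient. *)
Lemma peel_P0 (Z : obj1 K) :
  (limg (emb Z) <= limg (Tend K (amb Z)))%VS -> \dim {:N K (amb Z)} != 0%N ->
  exists (X : obj1 K) (n : nat),
  [/\ (\dim {:N K (amb X)} < \dim {:N K (amb Z)})%N, (0 < n)%N,
      extension (P01_sum K n) X Z &
      \dim (limg (Tend K (amb Z))) = \dim {:N K (amb X)}].
Proof.
set V := N K (amb Z); set t := Tend K (amb Z) => UT V0.
have [k tk] := Tend_nilpotent K (amb Z).
have tlt : (\dim (limg t) < \dim {:V})%N.
  apply: (@nilpotent_img_lt K V t fullv k); first by move=> x _; exact: tk.
    exact: subvf.
  by rewrite -dimv_eq0.
pose n := (\dim {:V} - \dim (limg t))%N.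
have dV : \dim {:V} = (\dim (limg t) + \dim {:N K (part1 n)})%N.
  by rewrite dim_part1 subnKC // ltnW.
have [g [kg ig]] := ex_lfun_ker dV.
have [||||X [f [kf fH tf fU]]] := @realize_obj1 K V t (limg t) (limg (emb Z)) k.
- by move=> x _; exact: tk.
- by rewrite limgS ?subvf.
- exact: UT.
- exact: limg_emb_ker.
have dX : \dim (limg t) = \dim {:N K (amb X)} by rewrite -fH dim_limg_inj.
exists X, n; split=> //; first by rewrite -dX.
  by rewrite subn_gt0.
apply: (@extension_of_amb K X Z (P01_sum K n) f g) => //.
- by split; rewrite ?fH ?kg.
- rewrite [X in (X \o _)%VF]Tend_nseq1 comp_lfun0l; apply/lfunP => x.
  rewrite zero_lfunE comp_lfunE; apply/esym/eqP; rewrite -memv_ker kg.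
  by rewrite memv_img ?memvf.
- by rewrite fH fU; apply/esym/capv_idPl.
- apply/eqP; rewrite eqEsubv; apply/andP; split; apply/subvP => x.
    case/memv_imgP => y yU ->; have : y \in lker g by rewrite kg (subvP UT).
    by rewrite memv_ker => /eqP ->; rewrite mem0v.
  by case/memv_imgP => y _ ->; rewrite /= zero_lfunE mem0v.
Qed.

Lemma dim_amb0_iso (Z : obj1 K) : \dim {:N K (amb Z)} = 0%N -> iso Z (zero_obj K).
Proof.
move=> d0; have e0 : {:N K (amb Z)}%VS = 0%VS by apply/eqP; rewrite -dimv_eq0 d0.
have z0 (x : N K (amb Z)) : x = 0 by apply/eqP; rewrite -memv0 -e0 memvf.
apply: (@iso_of_amb K Z (zero_obj K) 0).
- by apply/eqP/lker0P => x y _; rewrite (z0 x) (z0 y).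
- by apply/vspaceP => x; rewrite memvf (thinmx0 x) mem0v.
- by rewrite comp_lfun0l comp_lfun0r.
- by apply/vspaceP => x; rewrite (thinmx0 x) !mem0v.
Qed.

(** Induction on the dimension of the ambient module, with the two ways to peel
    off a generator. *)
Lemma cls_in_submonoid (S : set (M K)) (Z : obj1 K) :
  submonoid S -> S (cls (P11 K)) ->
  (forall n, (0 < n)%N -> S (cls (P01_sum K n))) -> S (cls Z).
Proof.
case=> S0 Sm SP11 SP0; have [m] := ubnP (\dim {:N K (amb Z)}).
elim: m Z => // m IHm Z; rewrite ltnS => dZ.
have [UT|UT] := boolP (limg (emb Z) <= limg (Tend K (amb Z)))%VS.
  have [d0|d0] := eqVneq (\dim {:N K (amb Z)}) 0%N.
    by have /clsP -> := dim_amb0_iso d0.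
  have [X [n [dX n0 extZ dT]]] := peel_P0 UT d0.
  have genZ := generic_extensionP extZ.
  have /clsP <- := radical_extension_generic extZ dT genZ.
  by rewrite -mulM_cls; apply: Sm; [exact: SP0|exact/IHm/(leq_trans dX)].
have [X dX extZ] := peel_P11 UT.
have [extG _] := generic_extensionP extZ.
have /clsP <- := extension_P11_unique extG extZ.
by rewrite -mulM_cls; apply: Sm => //; exact/IHm/(leq_trans dX).
Qed.

End Generic.

Theorem lemma6p6 (K : closedFieldType) :
  smallest (@submonoid K)
    ([set cls (P11 K)] `|` [set cls (P01_sum K n) | n in [set n | (1 <= n)%N]])
  = [set: M K].
Proof.
apply/seteqP; split=> // a _ S [Sm genS].
rewrite -[a]reprK; apply: cls_in_submonoid => //.
  by apply: genS; left.
by move=> n n0; apply: genS; right; exists n.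
Qed.
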